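(* Let $1\le p_0,p_1,q_0,q_1<\infty$ with $p_0\le q_0$, $p_1\le q_1$, $p_0<p_1$, $q_0<q_1$, and let $T$ be a linear operator which is simultaneously of strong type $(p_0,q_0)$ and $(p_1,q_1)$: $$|T[f]|_{q_0}\le M_0|f|_{p_0},\qquad |T[f]|_{q_1}\le M_1|f|_{p_1},\qquad M_0,M_1=\mathrm{const}.$$ For $q\in(q_0,q_1)$ put $$r_{RT}(q)=\frac{p_0p_1(q_1-q_0)q}{p_0q_1(q-q_0)+p_1q_0(q_1-q)},\qquad \Theta(q)=\frac{q_1(q-q_0)}{q(q_1-q_0)},\qquad M_\theta(q)=2M_0^{1-\Theta(q)}M_1^{\Theta(q)},$$ and for $\psi\in\Psi(p_0,p_1)$ define $$\psi_{RT}(q)=M_\theta(q)\cdot\psi\left(r_{RT}(q)\right),\qquad q\in(q_0,q_1).$$ Then for each function $f\in G\psi$, $$\|T[f]\|G\psi_{RT}\le\|f\|G\psi .$$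
   Context: $(X,\mathcal A,\mu)$ and $(Y,\mathcal B,\nu)$ are measurable spaces with sigma-finite non-trivial resonant measures (a measure is resonant if it is either atomless, or discrete with all atoms of equal measure). $T$ maps measurable functions $f:X\to\mathbb R$ to measurable functions $Y\to\mathbb R$; $|f|_p$ is the $L_p(X,\mu)$ norm and $|T[f]|_q$ the $L_q(Y,\nu)$ norm. $\Psi(A,B)$ is the set of continuous positive functions $\psi$ on the open interval $(A,B)$ with $\inf_{p\in(A,B)}\psi(p)>0$. The Grand Lebesgue Space $G\psi$ consists of all measurable $f$ with finite norm $\|f\|G\psi=\sup_{p\in(A,B)}|f|_p/\psi(p)$. The norm $\|g\|G\psi_{RT}$ is $\sup_{q\in(q_0,q_1)}|g|_q/\psi_{RT}(q)$. *)

(* Defs.v *)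
From HB Require Import structures.
From mathcomp Require Import all_boot all_order all_algebra.
From mathcomp Require Import all_classical all_reals all_analysis.
From mathcomp Require Import measurable_realfun.

Set Implicit Arguments.
Unset Strict Implicit.
Unset Printing Implicit Defensive.

Import Order.TTheory GRing.Theory Num.Theory.
Import numFieldNormedType.Exports.

Local Open Scope classical_set_scope.
Local Open Scope ring_scope.

Section resonant_measures.
Context (d : measure_display) (X : measurableType d) (R : realType).
Variable mu : {measure set X -> \bar R}.

Definition is_atom (A : set X) : Prop :=
  [/\ measurable A, (0 < mu A)%E &
      forall B, measurable B -> B `<=` A -> mu B = 0%E \/ mu B = mu A].

Definition atomless : Prop := forall A, ~ is_atom A.

Definition discrete_measure : Prop :=
  forall A, measurable A -> (0 < mu A)%E -> exists2 B, is_atom B & B `<=` A.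

Definition resonant : Prop :=
  atomless \/
  (discrete_measure /\ forall A B, is_atom A -> is_atom B -> mu A = mu B).

End resonant_measures.

Section grand_lebesgue.
Context (d : measure_display) (X : measurableType d) (R : realType).

Definition Psi (A B : R) : set (R -> R) :=
  [set psi : R -> R | [/\ {in `]A, B[, continuous psi},
                 (forall p : R, A < p < B -> 0 < psi p) &
                 0 < inf (psi @` `]A, B[%classic)]].

(* The quotient is taken in the extended reals, where a / 0 = +oo for a > 0
   and 0 / 0 = 0. This matters only for weights that are not positive. *)
Definition GLnorm (mu : {measure set X -> \bar R}) (A B : R) (psi : R -> R)
    (f : X -> R) : \bar R :=
  ereal_sup [set ('N[mu]_(p%:E)[EFin \o f] / (psi p)%:E)%E
            | p in `]A, B[%classic].

Definition GLspace (mu : {measure set X -> \bar R}) (A B : R) (psi : R -> R)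
    : set {mfun X >-> R} :=
  [set f | (GLnorm mu A B psi f < +oo)%E].

Definition Lsum (mu : {measure set X -> \bar R}) (p0 p1 : R)
    : set {mfun X >-> R} :=
  [set f : {mfun X >-> R} | exists g h : {mfun X >-> R},
    [/\ finite_norm mu p0%:E g, finite_norm mu p1%:E h & f = g + h]].

End grand_lebesgue.

Section operators.
Context (d d' : measure_display) (X : measurableType d) (Y : measurableType d').
Context (R : realType).

(* Measurable functions are identified up to null sets, so linearity is only
   asked almost everywhere; the values of T outside E play no role. *)
Definition linear_operator_on (nu : {measure set Y -> \bar R})
    (E : set {mfun X >-> R}) (T : {mfun X >-> R} -> {mfun Y >-> R}) : Prop :=
  forall (a : R) (f g : {mfun X >-> R}), E f -> E g ->
    {ae nu, forall y, T (a *: f + g) y = a * T f y + T g y}.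

Definition strong_type (mu : {measure set X -> \bar R})
    (nu : {measure set Y -> \bar R}) (p q M : R)
    (T : {mfun X >-> R} -> {mfun Y >-> R}) : Prop :=
  forall f : {mfun X >-> R}, finite_norm mu p%:E f ->
    ('N[nu]_(q%:E)[EFin \o T f] <= M%:E * 'N[mu]_(p%:E)[EFin \o f])%E.

End operators.

Section riesz_thorin_parameters.
Context (R : realType).

Definition r_RT (p0 p1 q0 q1 q : R) : R :=
  (p0 * p1 * (q1 - q0) * q) /
  (p0 * q1 * (q - q0) + p1 * q0 * (q1 - q)).

Definition Theta (q0 q1 q : R) : R := (q1 * (q - q0)) / (q * (q1 - q0)).

Definition M_theta (M0 M1 q0 q1 q : R) : R :=
  2 * M0 `^ (1 - Theta q0 q1 q) * M1 `^ (Theta q0 q1 q).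

Definition psi_RT (p0 p1 q0 q1 M0 M1 : R) (psi : R -> R) (q : R) : R :=
  M_theta M0 M1 q0 q1 q * psi (r_RT p0 p1 q0 q1 q).

End riesz_thorin_parameters.

(* Main.v *)
Require Import Defs.
From HB Require Import structures.
From mathcomp Require Import all_boot all_order all_algebra.
From mathcomp Require Import all_classical all_reals all_analysis.
From mathcomp Require Import measurable_realfun.
From mathcomp Require Import ring lra.

Set Implicit Arguments.
Unset Strict Implicit.
Unset Printing Implicit Defensive.

Import Order.TTheory GRing.Theory Num.Theory.
Import numFieldNormedType.Exports.

Local Open Scope classical_set_scope.
Local Open Scope ring_scope.

(** The classical route to the Riesz-Thorin theorem goes through complex
    analysis, the factor 2 being the price of complexifying a real operator.
    Here the same factor comes out of a purely real argument, in the spirit of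
    Peetre's L-functional.

    Fix r strictly between p0 and p1.  For every level v, cut f at height
    e^v into a large part f_0 (where |f| > e^v) and a small part f_1 (where
    |f| <= e^v), so that T f = T f_0 + T f_1 almost everywhere.  With
    G = |T f| / 2, at almost every point |T f_0| or |T f_1| is at least G, hence for
    all A, B, tau > 0,

      min (G^q0 e^(A v), tau G^q1 e^(-B v))
        <= e^(A v) |T f_0|^q0 + tau e^(-B v) |T f_1|^q1.

    This is integrated over Y and over all levels v.

    - On the left, the integral over v is explicit
      ([integral_min_expR]) and gives, after Tonelli, a constant times
      the integral of G^q, where q is a weighted mean of q0 and q1.
    - On the right, the strong type inequalities bound the integral of
      |T f_i|^qi by M_i^qi (int |f_i|^pi)^(qi/pi).  As qi/pi >= 1, Jensen's
      inequality for the finite measure |f|^r mu moves the power inside the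
      integral ([weighted_jensen], [strong_type_interpolated]).  For the choice
      A = (r - p0) q0/p0 and B = (p1 - r) q1/p1 the integral over v then
      reproduces |f|^r up to explicit constants ([integral_over_levels]).

    All the constants 1/A and 1/B cancel for the optimal tau, and only the
    factor 2 in the definition of G remains: this is
    [power_integral_le_of_splittings], and in terms of norms
    [interpolation_norms].  The inequality between the Grand Lebesgue norms
    follows by comparing, for each q, the quotient at q with the one
    at r_RT(q). *)

(** * Integrals of exponentials over the real line *)

Section exponential_integrals.
Context (R : realType).
Notation leb := (@lebesgue_measure R).

Lemma measurable_expRM (s : R) : measurable_fun setT (fun v : R => expR (s * v)).
Proof. by apply: measurableT_comp => //; exact: mulrl_measurable. Qed.

Lemma measurable_expRNM (s : R) :
  measurable_fun setT (fun v : R => expR (- (s * v))).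
Proof. by under eq_fun do rewrite -mulNr; exact: measurable_expRM. Qed.

Lemma integral_expR_right (b h : R) : 0 < b ->
  (\int[leb]_(v in `[h, +oo[) (expR (- (b * v)))%:E = (expR (- (b * h)) / b)%:E)%E.
Proof.
move=> b0.
have cE : continuous (fun v : R => expR (- (b * v))).
  move=> v; apply: continuous_comp; last exact: continuous_expR.
  by apply: continuousN; apply: continuousM => //; exact: cst_continuous.
have dE (v : R) : is_derive v (1 : R) (fun v : R => - expR (- (b * v)) / b) (expR (- (b * v))).
  apply: is_derive_eq.
  rewrite /GRing.scale/=; field; exact: lt0r_neq0.
rewrite (@ge0_continuous_FTC2y _ _ (fun v => - expR (- (b * v)) / b) _ 0)//.
- by rewrite -EFinB; congr EFin; rewrite sub0r mulNr opprK.
- exact: continuous_subspaceT.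
- rewrite -[0 in X in _ --> X](mul0r b^-1); apply: cvgM; last exact: cvg_cst.
  rewrite -oppr0; apply: cvgN.
  apply: (@cvg_comp _ _ _ (fun v => b * v) (fun z => expR (- z)) _ (pinfty_nbhs R));
    last exact: cvgr_expR.
  exact: gt0_cvgMry.
- apply: cvg_at_right_filter; apply: cvgM; [apply: cvgN; exact: cE|exact: cvg_cst].
- by move=> v _; rewrite derive1E derive_val.
Qed.

Lemma integral_expR_left (a h : R) : 0 < a ->
  (\int[leb]_(v in `]-oo, h]) (expR (a * v))%:E = (expR (a * h) / a)%:E)%E.
Proof.
move=> a0; have := @ge0_integration_by_substitutionNy R (fun v => expR (a * v)) (- h).
rewrite opprK => ->; first last.
- by move=> v _; exact: expR_ge0.
- apply: continuous_subspaceT => v; apply: continuous_comp; last exact: continuous_expR.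
  by apply: continuousM => //; exact: cst_continuous.
rewrite -[in RHS](opprK h) mulrN -integral_expR_right//.
by apply: eq_integral => v _ /=; rewrite mulrN.
Qed.

Lemma integral_expR_two_sided (a b h k l : R) : 0 < a -> 0 < b -> 0 <= k -> 0 <= l ->
  (\int[leb]_v (if (v < h)%R then k * expR (a * v) else l * expR (- (b * v)))%:E =
   (k * (expR (a * h) / a) + l * (expR (- (b * h)) / b))%:E)%E.
Proof.
move=> a0 b0 k0 l0.
have mF : measurable_fun setT
    (fun v : R => if v < h then k * expR (a * v) else l * expR (- (b * v))).
  apply: measurable_fun_ifT.
  - exact: measurable_fun_ltr.
  - by apply: measurable_funM => //; exact: measurable_expRM.
  - by apply: measurable_funM => //; exact: measurable_expRNM.
have -> : [set: R] = `]-oo, h[%classic `|` `[h, +oo[%classic.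
  by rewrite -setCitvr setvU.
rewrite ge0_integral_setU//=; first last.
- by rewrite disj_set2E -setCitvr setICl.
- by move=> v _; rewrite lee_fin; case: ifP => _; rewrite mulr_ge0 ?expR_ge0.
- by apply/measurable_EFinP; apply: measurable_funTS.
rewrite EFinD; congr (_ + _)%E.
- transitivity (\int[leb]_(v in `]-oo, h[) (k%:E * (expR (a * v))%:E))%E.
    by apply: eq_integral => v; rewrite inE/= in_itv/= => ->.
  rewrite ge0_integralZl_EFin//; last first.
    by apply/measurable_EFinP; apply: measurable_funTS; exact: measurable_expRM.
  rewrite integral_itv_bndo_bndc ?integral_expR_left//.
  by apply/measurable_EFinP; apply: measurable_funTS; exact: measurable_expRM.
- transitivity (\int[leb]_(v in `[h, +oo[) (l%:E * (expR (- (b * v)))%:E))%E.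
    by apply: eq_integral => v; rewrite inE/= in_itv/= andbT => hv; rewrite ltNge hv.
  rewrite ge0_integralZl_EFin//; last first.
    by apply/measurable_EFinP; apply: measurable_funTS; exact: measurable_expRNM.
  by rewrite integral_expR_right.
Qed.

(** Integrating the minimum over all levels turns a pair k, l into the weighted
    geometric mean of k and l. This is what recovers G^q from G^q0 and G^q1. *)
Lemma integral_min_expR (a b k l : R) : 0 < a -> 0 < b -> 0 <= k -> 0 <= l ->
  (\int[leb]_v (Num.min (k * expR (a * v)) (l * expR (- (b * v))))%:E =
   (k `^ (b / (a + b)) * l `^ (a / (a + b)) * (a^-1 + b^-1))%:E)%E.
Proof.
move=> a0 b0; have ab0 : 0 < a + b by exact: addr_gt0.
rewrite le_eqVlt => /predU1P[<- l0|k0].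
  rewrite powR0 ?mulf_neq0 ?invr_neq0 ?lt0r_neq0// !mul0r integral0_eq// => v _.
  by rewrite mul0r min_l// mulr_ge0// expR_ge0.
rewrite le_eqVlt => /predU1P[<-|l0].
  rewrite powR0 ?mulf_neq0 ?invr_neq0 ?lt0r_neq0// mulr0 mul0r integral0_eq// => v _.
  by rewrite mul0r min_r// mulr_ge0 ?expR_ge0 ?ltW.
(* the two branches cross at v = h *)
pose h := (ln l - ln k) / (a + b).
have kE : k = expR (ln k) by rewrite lnK.
have lE : l = expR (ln l) by rewrite lnK.
transitivity (\int[leb]_v
    (if v < h then k * expR (a * v) else l * expR (- (b * v)))%:E)%E.
  apply: eq_integral => v _; congr EFin; rewrite kE lE -!expRD.
  have le_h : (ln k + a * v <= ln l - b * v) = (v <= h).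
    by rewrite /h ler_pdivlMr//; apply/idP/idP; lra.
  have [vh|hv] := ltP v h; first by rewrite min_l// ler_expR le_h ltW.
  rewrite min_r// ler_expR; move: hv; rewrite /h ler_pdivrMr//; lra.
rewrite integral_expR_two_sided ?ltW//; congr EFin.
have kaE : k * expR (a * h) = k `^ (b / (a + b)) * l `^ (a / (a + b)).
  rewrite /powR !gt_eqF// {1}kE -!expRD /h; congr expR.
  field; exact: lt0r_neq0.
have lbE : l * expR (- (b * h)) = k `^ (b / (a + b)) * l `^ (a / (a + b)).
  rewrite /powR !gt_eqF// {1}lE -!expRD /h; congr expR.
  field; exact: lt0r_neq0.
by rewrite [k * _]mulrA [l * _]mulrA kaE lbE mulrDr.
Qed.

End exponential_integrals.

(** * Jensen's inequality for a weighted measure *)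

(** Convexity of u |-> u ^ rho at the point m, in the guise of Young's inequality.
    It contains no subtraction, so that both sides can be integrated. *)
Lemma young_tangent (R : realType) (rho u m : R) : 1 <= rho -> 0 <= u -> 0 <= m ->
  rho * m `^ (rho - 1) * u <= u `^ rho + (rho - 1) * m `^ rho.
Proof.
rewrite le_eqVlt => /predU1P[<- u0 m0|rho1 u0 m0].
  by rewrite subrr powRr0 mul0r addr0 !mul1r powRr1.
have rho0 : 0 < rho by exact: lt_trans rho1.
have rho10 : 0 < rho - 1 by rewrite subr_gt0.
have := @conjugate_powR _ u (m `^ (rho - 1)) rho (rho / (rho - 1)) u0 (powR_ge0 _ _) rho0.
rewrite -powRrM [(rho - 1) * _]mulrC divfK ?lt0r_neq0// => /(_ (divr_gt0 rho0 rho10)) yng.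
have {}yng : u * m `^ (rho - 1) <= u `^ rho / rho + m `^ rho / (rho / (rho - 1)).
  by apply: yng; field; rewrite !lt0r_neq0.
have -> : rho * m `^ (rho - 1) * u = rho * (u * m `^ (rho - 1)) by ring.
apply: (le_trans (ler_wpM2l (ltW rho0) yng)).
rewrite le_eqVlt; apply/orP; left; apply/eqP; field; rewrite !lt0r_neq0//.
Qed.

Section weighted_jensen.
Context d (X : measurableType d) (R : realType) (mu : {measure set X -> \bar R}).

(** Integrate the tangent inequality at the mean value m of u against the weight
    w. The bound F only has to dominate the total mass of w, because the power
    rho - 1 of F is nonnegative. *)
Lemma weighted_jensen (u w : X -> R) (F rho : R) :
  measurable_fun setT u -> measurable_fun setT w ->
  (forall x, 0 <= u x) -> (forall x, 0 <= w x) ->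
  0 < F -> 1 <= rho -> (\int[mu]_x (w x)%:E <= F%:E)%E ->
  (\int[mu]_x (u x * w x)%:E < +oo)%E ->
  ((\int[mu]_x (u x * w x)%:E) `^ rho <=
   (F `^ (rho - 1))%:E * \int[mu]_x (u x `^ rho * w x)%:E)%E.
Proof.
move=> m_u mw u0 w0 F0 rho1 wF ufin.
have I0 : (0 <= \int[mu]_x (u x * w x)%:E)%E.
  by apply: integral_ge0 => x _; rewrite lee_fin mulr_ge0.
have [s sE] : exists s : R, (\int[mu]_x (u x * w x)%:E = s%:E)%E.
  by exists (fine (\int[mu]_x (u x * w x)%:E)); rewrite fineK// ge0_fin_numE.
have s0 : 0 <= s by rewrite -lee_fin -sE.
rewrite sE; pose m := s / F.
have m0 : 0 <= m by rewrite divr_ge0// ltW.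
have rho0 : 0 < rho by exact: lt_le_trans rho1.
have r10 : 0 <= rho - 1 by rewrite subr_ge0.
have mpu : measurable_fun setT (fun x => u x `^ rho).
  exact: (measurableT_comp (measurable_powR rho)).
have J0 : (0 <= \int[mu]_x (u x `^ rho * w x)%:E)%E.
  by apply: integral_ge0 => x _; rewrite lee_fin mulr_ge0 ?powR_ge0.
have key : ((rho * m `^ (rho - 1))%:E * s%:E <=
    \int[mu]_x (u x `^ rho * w x)%:E + ((rho - 1) * m `^ rho)%:E * F%:E)%E.
  rewrite -sE -ge0_integralZl_EFin//; first last.
  - by rewrite mulr_ge0 ?powR_ge0// ltW.
  - by apply/measurable_EFinP; apply: measurable_funM.
  - by move=> x _; rewrite lee_fin mulr_ge0.
  apply: (@le_trans _ _ (\int[mu]_x (u x `^ rho * w x)%:E +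
      ((rho - 1) * m `^ rho)%:E * \int[mu]_x (w x)%:E)%E); last first.
    by apply: leeD2l; apply: lee_wpmul2l => //; rewrite lee_fin mulr_ge0 ?powR_ge0.
  rewrite -ge0_integralZl_EFin//; first last.
  - by rewrite mulr_ge0 ?powR_ge0.
  - exact/measurable_EFinP.
  - by move=> x _; rewrite lee_fin.
  rewrite -ge0_integralD//; first last.
  - by apply/measurable_EFinP; exact: measurable_funM.
  - by move=> x _; rewrite lee_fin !mulr_ge0 ?powR_ge0.
  - by apply/measurable_EFinP; exact: measurable_funM.
  - by move=> x _; rewrite lee_fin mulr_ge0 ?powR_ge0.
  apply: ge0_le_integral => //.
  - by move=> x _; rewrite lee_fin !mulr_ge0 ?powR_ge0 ?(ltW rho0).
  - by apply/measurable_EFinP; apply: measurable_funM => //; exact: measurable_funM.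
  - by apply/measurable_EFinP; apply: measurable_funD; exact: measurable_funM.
  move=> x _; rewrite -EFinM -EFinM -EFinD lee_fin mulrA -mulrDl.
  by apply: ler_wpM2r => //; exact: young_tangent.
have mF : (m `^ rho * F)%:E =
    ((rho * m `^ (rho - 1))%:E * s%:E - ((rho - 1) * m `^ rho)%:E * F%:E)%E.
  rewrite -!EFinM -EFinB; congr EFin.
  have -> : s = m * F by rewrite /m divfK// lt0r_neq0.
  have -> : rho * m `^ (rho - 1) * (m * F) = rho * (m * m `^ (rho - 1)) * F by ring.
  by rewrite mulr_powRB1//; ring.
have {key} : ((m `^ rho * F)%:E <= \int[mu]_x (u x `^ rho * w x)%:E)%E.
  by rewrite mF leeBlDr.
move=> /(@lee_wpmul2l _ (F `^ (rho - 1))%:E); rewrite lee_fin powR_ge0 => /(_ isT).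
apply: le_trans; rewrite -EFinM lee_fin.
have -> : s = F * m by rewrite /m mulrC divfK// lt0r_neq0.
by rewrite powRM ?(ltW F0)// -(mulr_powRB1 (ltW F0) rho0) le_eqVlt;
  apply/orP; left; apply/eqP; ring.
Qed.

End weighted_jensen.

(** * Integration over all levels of truncation *)

Lemma measurable_absr_powR (R : realType) d (X : measurableType d)
    (h : {mfun X >-> R}) (s : R) : measurable_fun setT (fun x => `|h x| `^ s).
Proof.
apply: (measurableT_comp (measurable_powR s)).
exact: measurableT_comp.
Qed.

(** One of the two summands carries at least half of their sum. This is the only
    source of the constant 2. *)
Lemma min_half_le (R : realType) (q0 q1 k l x0 x1 : R) :
  0 <= q0 -> 0 <= q1 -> 0 <= k -> 0 <= l ->
  Num.min ((`|x0 + x1| / 2) `^ q0 * k) ((`|x0 + x1| / 2) `^ q1 * l) <=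
  k * `|x0| `^ q0 + l * `|x1| `^ q1.
Proof.
move=> q00 q10 k0 l0.
have half0 : 0 <= `|x0 + x1| / 2 by rewrite divr_ge0.
have tri := ler_normD x0 x1.
rewrite ge_min; have [le01|lt10] := leP `|x0| `|x1|.
- apply/orP; right; rewrite mulrC; apply: (@le_trans _ _ (l * `|x1| `^ q1)); last first.
    by rewrite lerDr mulr_ge0 ?powR_ge0.
  apply: ler_wpM2l => //; apply: ge0_ler_powR; rewrite ?nnegrE//.
  by rewrite ler_pdivrMr//; lra.
- apply/orP; left; rewrite mulrC; apply: (@le_trans _ _ (k * `|x0| `^ q0)); last first.
    by rewrite lerDl mulr_ge0 ?powR_ge0.
  apply: ler_wpM2l => //; apply: ge0_ler_powR; rewrite ?nnegrE//.
  by rewrite ler_pdivrMr//; lra.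
Qed.

Section splitting_at_all_levels.
Context (R : realType) (d d' : measure_display).
Context (X : measurableType d) (Y : measurableType d').
Variables (mu : {sigma_finite_measure set X -> \bar R}).
Variables (nu : {sigma_finite_measure set Y -> \bar R}).
Notation leb := (@lebesgue_measure R).
Variables (f : {mfun X >-> R}) (r A B : R).
Hypotheses (r0 : 0 < r) (A0 : 0 < A) (B0 : 0 < B).

(** The densities |f|^(r-A) and |f|^(r+B) on the parts of X where |f| > e^v and
    |f| <= e^v. The product form makes both vanish where f does, whatever the
    sign of r - A, and the value ln 0 = 0 is then harmless. *)
Definition large_density (v : R) (x : X) : R :=
  if v < ln `|f x| then `|f x| `^ (- A) * `|f x| `^ r else 0.

Definition small_density (v : R) (x : X) : R :=
  if v < ln `|f x| then 0 else `|f x| `^ B * `|f x| `^ r.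

Lemma measurable_level : measurable_fun setT (fun z : R * X => z.1 < ln `|f z.2|).
Proof.
apply: measurable_fun_ltr => //.
apply: measurableT_comp; first exact: measurable_ln.
by apply: measurableT_comp => //; apply: measurableT_comp.
Qed.

Lemma measurable_large_density : measurable_fun setT (fun z : R * X => large_density z.1 z.2).
Proof.
apply: measurable_fun_ifT => //; first exact: measurable_level.
by apply: measurable_funM;
  apply: (measurableT_comp (f := fun x => `|f x| `^ _)) => //;
  exact: measurable_absr_powR.
Qed.

Lemma measurable_small_density : measurable_fun setT (fun z : R * X => small_density z.1 z.2).
Proof.
apply: measurable_fun_ifT => //; first exact: measurable_level.
by apply: measurable_funM;
  apply: (measurableT_comp (f := fun x => `|f x| `^ _)) => //;
  exact: measurable_absr_powR.
Qed.

Lemma large_density_ge0 v x : 0 <= large_density v x.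
Proof. by rewrite /large_density; case: ifP => // _; rewrite mulr_ge0 ?powR_ge0. Qed.

Lemma small_density_ge0 v x : 0 <= small_density v x.
Proof. by rewrite /small_density; case: ifP => // _; rewrite mulr_ge0 ?powR_ge0. Qed.

(** For fixed x, the level v runs over a half-line ending at ln |f x|; the
    exponentials integrate to |f x|^A / A and |f x|^(-B) / B and restore the
    density |f x|^r. *)
Lemma integral_over_levels (k l : R) : 0 <= k -> 0 <= l ->
  (\int[leb]_v (\int[mu]_x (k * expR (A * v) * large_density v x +
                            l * expR (- (B * v)) * small_density v x)%:E) =
   (k / A + l / B)%:E * \int[mu]_x (`|f x| `^ r)%:E)%E.
Proof.
move=> k0 l0.
have mL : measurable_fun setT (fun z : R * X =>
    (k * expR (A * z.1) * large_density z.1 z.2 +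
     l * expR (- (B * z.1)) * small_density z.1 z.2)%:E).
  apply/measurable_EFinP; apply: measurable_funD; apply: measurable_funM => //.
  - apply: measurable_funM => //; exact: (measurableT_comp (measurable_expRM A)).
  - exact: measurable_large_density.
  - apply: measurable_funM => //; exact: (measurableT_comp (measurable_expRNM B)).
  - exact: measurable_small_density.
rewrite (@fubini_tonelli _ _ _ _ _ leb mu _ mL) => [|z]; last first.
  by rewrite lee_fin addr_ge0// mulr_ge0 ?large_density_ge0 ?small_density_ge0// mulr_ge0 ?expR_ge0.
rewrite -ge0_integralZl_EFin//; first last.
- by rewrite addr_ge0// divr_ge0// ltW.
- by apply/measurable_EFinP; exact: measurable_absr_powR.
apply: eq_integral => x _ /=.
have [fx0|fx0] := eqVneq `|f x| 0.
  rewrite /large_density /small_density fx0 (powR0 (lt0r_neq0 r0)) mule0 integral0_eq// => v _.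
  by rewrite !mulr0 !if_same !mulr0 addr0.
have fxgt0 : 0 < `|f x| by rewrite lt_neqAle eq_sym fx0 normr_ge0.
transitivity (\int[leb]_v
    (if v < ln `|f x| then (k * (`|f x| `^ (- A) * `|f x| `^ r)) * expR (A * v)
     else (l * (`|f x| `^ B * `|f x| `^ r)) * expR (- (B * v)))%:E)%E.
  apply: eq_integral => v _; congr EFin; rewrite /large_density /small_density.
  by case: ifP => _; rewrite mulr0 ?addr0 ?add0r mulrAC.
rewrite integral_expR_two_sided ?mulr_ge0 ?powR_ge0// -EFinM; congr EFin.
have eA : expR (A * ln `|f x|) = `|f x| `^ A by rewrite /powR gt_eqF.
have eB : expR (- (B * ln `|f x|)) = (`|f x| `^ B)^-1 by rewrite -powRN /powR gt_eqF// mulNr.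
rewrite eA eB powRN; field.
by rewrite !lt0r_neq0 ?powR_gt0.
Qed.

(** Interpolation in its abstract form: what matters about g is only that at
    every level v it splits into two functions controlled by the part of f
    above e^v and by the part of f below e^v respectively. *)
Lemma power_integral_le_of_splittings (g : {mfun Y >-> R}) (q0 q1 a b F : R) :
  0 < q0 -> 0 < q1 -> 0 < a -> 0 < b ->
  (\int[mu]_x (`|f x| `^ r)%:E <= F%:E)%E ->
  (forall v : R, exists g0 g1 : {mfun Y >-> R},
    [/\ {ae nu, forall y, g y = g0 y + g1 y},
     (\int[nu]_y (`|g0 y| `^ q0)%:E <= a%:E * \int[mu]_x (large_density v x)%:E)%E &
     (\int[nu]_y (`|g1 y| `^ q1)%:E <= b%:E * \int[mu]_x (small_density v x)%:E)%E]) ->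
  (\int[nu]_y ((`|g y| / 2) `^ (q0 * (B / (A + B)) + q1 * (A / (A + B))))%:E <=
   (a `^ (B / (A + B)) * b `^ (A / (A + B)) * F)%:E)%E.
Proof.
move=> q00 q10 a0 b0 fF split.
have AB0 : 0 < A + B by exact: addr_gt0.
set e0 := B / (A + B); set e1 := A / (A + B).
have e00 : 0 < e0 by exact: divr_gt0.
have e10 : 0 < e1 by exact: divr_gt0.
(* this value makes the coefficients of 1/A and 1/B on the right-hand side
   equal *)
pose tau := a / b.
have tau0 : 0 < tau by exact: divr_gt0.
pose G y := `|g y| / 2.
have G0 y : 0 <= G y by rewrite divr_ge0.
have mG s : measurable_fun setT (fun y => G y `^ s).
  apply: (measurableT_comp (measurable_powR s)).
  by apply: measurable_funM => //; exact: measurableT_comp.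
pose H (z : R * Y) := Num.min (G z.2 `^ q0 * expR (A * z.1))
                              (tau * G z.2 `^ q1 * expR (- (B * z.1))).
have H0 z : (0 <= (H z)%:E)%E.
  rewrite lee_fin le_min; apply/andP; split; rewrite mulr_ge0 ?expR_ge0 ?powR_ge0//.
  by rewrite mulr_ge0 ?powR_ge0// ltW.
have mH : measurable_fun setT (EFin \o H).
  apply/measurable_EFinP; apply: measurable_minr; apply: measurable_funM.
  - exact: (measurableT_comp (mG q0)).
  - exact: (measurableT_comp (measurable_expRM A)).
  - apply: measurable_funM => //; exact: (measurableT_comp (mG q1)).
  - exact: (measurableT_comp (measurable_expRNM B)).
pose c := tau `^ e1 * (A^-1 + B^-1).
have c0 : 0 < c by rewrite mulr_gt0 ?powR_gt0// addr_gt0// invr_gt0.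
have lowerE : (\int[leb]_v \int[nu]_y (H (v, y))%:E =
    c%:E * \int[nu]_y (G y `^ (q0 * e0 + q1 * e1))%:E)%E.
  rewrite (@fubini_tonelli _ _ _ _ _ leb nu _ mH)//.
  rewrite -ge0_integralZl_EFin ?(ltW c0)//; first last.
  - exact/measurable_EFinP.
  - by move=> y _; rewrite lee_fin powR_ge0.
  apply: eq_integral => y _ /=; rewrite /H /=.
  have tG0 : 0 <= tau * G y `^ q1 by rewrite mulr_ge0 ?powR_ge0// ltW.
  rewrite (integral_min_expR A0 B0 (powR_ge0 _ _) tG0) -EFinM; congr EFin.
  rewrite (powRM _ (ltW tau0) (powR_ge0 _ _)) -/e0 -/e1 -!powRrM powRD; last first.
    by rewrite gt_eqF//; apply: addr_gt0; exact: mulr_gt0.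
  by rewrite /c; ring.
have level_le v : (\int[nu]_y (H (v, y))%:E <=
    \int[mu]_x (a * expR (A * v) * large_density v x +
                a * expR (- (B * v)) * small_density v x)%:E)%E.
  have [g0 [g1 [gE g0le g1le]]] := split v.
  have mu_up : measurable_fun setT (fun x => (large_density v x)%:E).
    by apply/measurable_EFinP; exact: (measurable_fun_pair2 v measurable_large_density).
  have mu_lo : measurable_fun setT (fun x => (small_density v x)%:E).
    by apply/measurable_EFinP; exact: (measurable_fun_pair2 v measurable_small_density).
  have mg0 : measurable_fun setT (fun y => (`|g0 y| `^ q0)%:E).
    by apply/measurable_EFinP; exact: measurable_absr_powR.
  have mg1 : measurable_fun setT (fun y => (`|g1 y| `^ q1)%:E).
    by apply/measurable_EFinP; exact: measurable_absr_powR.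
  have up0 : (0 <= expR (A * v))%R by exact: expR_ge0.
  have lo0 : (0 <= tau * expR (- (B * v)))%R by rewrite mulr_ge0 ?expR_ge0 ?ltW.
  apply: (@le_trans _ _ (\int[nu]_y ((expR (A * v))%:E * (`|g0 y| `^ q0)%:E +
      (tau * expR (- (B * v)))%:E * (`|g1 y| `^ q1)%:E))%E).
    apply: ae_ge0_le_integral => //.
    - exact: (measurable_fun_pair2 v mH).
    - by move=> y _; rewrite -!EFinM -EFinD lee_fin addr_ge0// mulr_ge0 ?powR_ge0.
    - by apply: emeasurable_funD; exact: measurable_funeM.
    apply: filterS gE => y gyE _; rewrite -!EFinM -EFinD lee_fin /H /= /G gyE.
    rewrite [tau * _]mulrC -mulrA; apply: min_half_le => //; exact: ltW.
  rewrite ge0_integralD; last 5 first.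
  - exact: measurableT.
  - by move=> y _; rewrite -EFinM lee_fin mulr_ge0 ?powR_ge0.
  - exact: measurable_funeM.
  - by move=> y _; rewrite -EFinM lee_fin mulr_ge0 ?powR_ge0.
  - exact: measurable_funeM.
  rewrite !ge0_integralZl_EFin//; try by move=> y _; rewrite lee_fin powR_ge0.
  under [leRHS]eq_integral do rewrite EFinD !EFinM.
  have aA0 : 0 <= a * expR (A * v) by rewrite mulr_ge0 ?expR_ge0// ltW.
  have aB0 : 0 <= a * expR (- (B * v)) by rewrite mulr_ge0 ?expR_ge0// ltW.
  rewrite ge0_integralD; last 5 first.
  - exact: measurableT.
  - by move=> x _; rewrite -!EFinM lee_fin mulr_ge0 ?large_density_ge0.
  - by under eq_fun do rewrite -EFinM; exact: measurable_funeM.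
  - by move=> x _; rewrite -!EFinM lee_fin mulr_ge0 ?small_density_ge0.
  - by under eq_fun do rewrite -EFinM; exact: measurable_funeM.
  rewrite -!EFinM (ge0_integralZl_EFin _ _ _ mu_up aA0)//; last first.
    by move=> x _; rewrite lee_fin large_density_ge0.
  rewrite (ge0_integralZl_EFin _ _ _ mu_lo aB0)//; last first.
    by move=> x _; rewrite lee_fin small_density_ge0.
  apply: leeD.
  - by rewrite [a * _]mulrC EFinM -muleA; exact: lee_wpmul2l.
  - have -> : a * expR (- (B * v)) = tau * expR (- (B * v)) * b.
      by rewrite /tau; field; exact: lt0r_neq0.
    by rewrite [in leRHS]EFinM -muleA; exact: lee_wpmul2l.
have cG_le : (c%:E * \int[nu]_y (G y `^ (q0 * e0 + q1 * e1))%:E <=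
    ((a / A + a / B) * F)%:E)%E.
  rewrite -lowerE; apply: (@le_trans _ _ ((a / A + a / B)%:E * \int[mu]_x (`|f x| `^ r)%:E)%E).
    rewrite -(integral_over_levels (ltW a0) (ltW a0)); apply: ge0_le_integral => //.
    - by move=> v _; apply: integral_ge0.
    - exact: (measurable_fun_fubini_tonelli_F (m2 := nu) _ mH).
    - apply: (measurable_fun_fubini_tonelli_F (m2 := mu) (fun z : R * X =>
        (a * expR (A * z.1) * large_density z.1 z.2 +
         a * expR (- (B * z.1)) * small_density z.1 z.2)%:E)).
      + apply/measurable_EFinP; apply: measurable_funD; apply: measurable_funM.
        * apply: measurable_funM => //; exact: (measurableT_comp (measurable_expRM A)).
        * exact: measurable_large_density.
        * apply: measurable_funM => //; exact: (measurableT_comp (measurable_expRNM B)).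
        * exact: measurable_small_density.
      + move=> z; rewrite lee_fin addr_ge0// mulr_ge0 ?large_density_ge0 ?small_density_ge0//.
        - by rewrite mulr_ge0 ?expR_ge0 ?ltW.
        - by rewrite mulr_ge0 ?expR_ge0 ?ltW.
  rewrite EFinM; apply: lee_wpmul2l => //.
  by rewrite lee_fin addr_ge0// divr_ge0 ?ltW.
move: cG_le; rewrite -lee_pdivlMl// => /le_trans; apply.
rewrite -EFinM lee_fin le_eqVlt; apply/orP; left; apply/eqP.
have aE : a = a `^ e0 * a `^ e1.
  rewrite -powRD; last by rewrite gt_eqF// addr_gt0.
  rewrite (_ : e0 + e1 = 1) ?powRr1 ?ltW// /e0 /e1; field; exact: lt0r_neq0.
rewrite /c /tau powRM ?ltW ?invr_gt0// -powR_inv1 ?ltW// -powRrM mulN1r powRN.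
have -> : a / A + a / B = a `^ e0 * a `^ e1 * (A^-1 + B^-1) by rewrite -aE mulrDr.
by field; rewrite !lt0r_neq0 ?powR_gt0// addrC.
Qed.

End splitting_at_all_levels.

(** * Truncation at level e^v *)

Section truncation.
Context (R : realType) (d : measure_display) (X : measurableType d).
Variables (mu : {measure set X -> \bar R}).
Variables (f : {mfun X >-> R}).

Definition large_set (v : R) : set X := [set x | v < ln `|f x|].

Lemma measurable_large_set v : measurable (large_set v).
Proof.
have mlev : measurable_fun setT (fun x => v < ln `|f x|).
  apply: measurable_fun_ltr => //.
  apply: measurableT_comp; first exact: measurable_ln.
  exact: measurableT_comp.
rewrite (_ : large_set v = setT `&` (fun x => v < ln `|f x|) @^-1` [set true]); last first.
  by rewrite setTI.
exact: mlev.
Qed.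

Definition large_part (v : R) : {mfun X >-> R} := f * mindic R (measurable_large_set v).
Definition small_part (v : R) : {mfun X >-> R} := f - large_part v.

Lemma large_partE v x : large_part v x = if v < ln `|f x| then f x else 0.
Proof.
rewrite /large_part mfunM/= mindicE/=.
case: ifPn => h; first by rewrite mem_set ?mulr1.
by rewrite memNset ?mulr0//; apply/negP.
Qed.

Lemma small_partE v x : small_part v x = if v < ln `|f x| then 0 else f x.
Proof.
have -> : small_part v x = f x - large_part v x by rewrite /small_part mfunB.
by rewrite large_partE; case: ifP; rewrite ?subrr ?subr0.
Qed.

Lemma large_add_small v : 1 *: large_part v + small_part v = f.
Proof. by rewrite scale1r /small_part addrC subrK. Qed.

(** The two parts of f are compared with |f|^r through the constant
    e^((p - r) v), as |f|^(p-r) is monotone in |f|. *)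
Let power_dominated_lty (h : {mfun X >-> R}) (p r c : R) : 0 <= c ->
  (forall x, `|h x| `^ p <= c * `|f x| `^ r) ->
  (\int[mu]_x (`|f x| `^ r)%:E < +oo)%E ->
  (\int[mu]_x (`|h x| `^ p)%:E < +oo)%E.
Proof.
move=> c0 hf fr.
apply: (@le_lt_trans _ _ (c%:E * \int[mu]_x (`|f x| `^ r)%:E)%E); last first.
  by apply: lte_mul_pinfty => //; rewrite lee_fin.
rewrite -ge0_integralZl_EFin//; last first.
  by apply/measurable_EFinP; exact: measurable_absr_powR.
apply: ge0_le_integral => //.
- by apply/measurable_EFinP; exact: measurable_absr_powR.
- by apply/measurable_EFinP; apply: measurable_funM => //; exact: measurable_absr_powR.
- by move=> x _; rewrite -EFinM lee_fin.
Qed.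

Lemma large_part_power_lty (p r v : R) : 0 < p -> p < r ->
  (\int[mu]_x (`|f x| `^ r)%:E < +oo)%E ->
  (\int[mu]_x (`|large_part v x| `^ p)%:E < +oo)%E.
Proof.
move=> p0 pr; apply: (@power_dominated_lty _ _ _ (expR ((p - r) * v))) => [|x].
  exact: expR_ge0.
rewrite large_partE.
case: ifPn => [vf|_]; last by rewrite normr0 powR0 ?gt_eqF// mulr_ge0 ?expR_ge0 ?powR_ge0.
have [->|fx0] := eqVneq `|f x| 0.
  by rewrite powR0 ?gt_eqF// mulr_ge0 ?expR_ge0 ?powR_ge0.
rewrite /powR (negbTE fx0) -expRD ler_expR.
have : 0 <= (r - p) * (ln `|f x| - v) by rewrite mulr_ge0// subr_ge0 ltW.
lra.
Qed.

Lemma small_part_power_lty (p r v : R) : 0 < r -> r < p ->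
  (\int[mu]_x (`|f x| `^ r)%:E < +oo)%E ->
  (\int[mu]_x (`|small_part v x| `^ p)%:E < +oo)%E.
Proof.
move=> r0 rp; have p0 : 0 < p by exact: lt_trans rp.
apply: (@power_dominated_lty _ _ _ (expR ((p - r) * v))) => [|x].
  exact: expR_ge0.
rewrite small_partE.
case: ifPn => [_|]; first by rewrite normr0 powR0 ?gt_eqF// mulr_ge0 ?expR_ge0 ?powR_ge0.
rewrite -leNgt => vf.
have [->|fx0] := eqVneq `|f x| 0.
  by rewrite powR0 ?gt_eqF// mulr_ge0 ?expR_ge0 ?powR_ge0.
rewrite /powR (negbTE fx0) -expRD ler_expR.
have : 0 <= (p - r) * (v - ln `|f x|) by rewrite mulr_ge0// subr_ge0// ltW.
lra.
Qed.

End truncation.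

(** * Strong type inequalities for powers *)

Section power_norms.
Context (R : realType) (d : measure_display) (X : measurableType d).
Variables (mu : {measure set X -> \bar R}).

Lemma finite_normE (p : R) (h : {mfun X >-> R}) :
  (\int[mu]_x (`|h x| `^ p)%:E < +oo)%E -> finite_norm mu p%:E h.
Proof. by move=> hp; rewrite /finite_norm unlock; exact: poweR_lty. Qed.

Lemma finite_norm0 (p : R) : p != 0 -> finite_norm mu p%:E (0 : {mfun X >-> R}).
Proof.
by move=> p0; rewrite /finite_norm (_ : EFin \o _ = cst 0%E)// Lnorm0.
Qed.

End power_norms.

Section strong_type_powers.
Context (R : realType) (d d' : measure_display).
Context (X : measurableType d) (Y : measurableType d').
Variables (mu : {measure set X -> \bar R}) (nu : {measure set Y -> \bar R}).

Lemma strong_type_power (T : {mfun X >-> R} -> {mfun Y >-> R}) (p q M : R)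
    (h : {mfun X >-> R}) :
  0 < p -> 0 < q -> 0 <= M -> strong_type mu nu p q M T ->
  (\int[mu]_x (`|h x| `^ p)%:E < +oo)%E ->
  (\int[nu]_y (`|T h y| `^ q)%:E <=
   (M `^ q)%:E * (\int[mu]_x (`|h x| `^ p)%:E) `^ (q / p))%E.
Proof.
move=> p0 q0 M0 TM hp.
have := TM _ (finite_normE hp).
set L := Lnorm nu _ _; set N := Lnorm mu _ _ => LN.
have -> : (\int[nu]_y (`|T h y| `^ q)%:E = L `^ q)%E by rewrite /L poweR_Lnorm ?gt_eqF//.
have -> : ((\int[mu]_x (`|h x| `^ p)%:E) `^ (q / p) = N `^ q)%E.
  by rewrite mulrC poweRrM /N unlock.
rewrite -poweR_EFin -poweRM//; last exact: Lnorm_ge0.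
apply: gt0_ler_poweR => //; first exact: ltW.
- by rewrite in_itv/= Lnorm_ge0 leey.
- by rewrite in_itv/= leey mule_ge0// Lnorm_ge0.
Qed.

(** The power q / p of the integral of |h|^p is moved inside by Jensen's
    inequality for the measure |h|^r mu, with |h|^p = |h|^(p-r) |h|^r. The result
    is linear in mu, so it can be integrated over the levels of truncation. *)
Lemma strong_type_interpolated (T : {mfun X >-> R} -> {mfun Y >-> R})
    (p q M r F : R) (h : {mfun X >-> R}) :
  0 < p -> p <= q -> 0 <= M -> 0 < r -> 0 < F -> strong_type mu nu p q M T ->
  (\int[mu]_x (`|h x| `^ p)%:E < +oo)%E ->
  (\int[mu]_x (`|h x| `^ r)%:E <= F%:E)%E ->
  (\int[nu]_y (`|T h y| `^ q)%:E <= (M `^ q * F `^ (q / p - 1))%:E *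
     \int[mu]_x (`|h x| `^ ((p - r) * (q / p)) * `|h x| `^ r)%:E)%E.
Proof.
move=> p0 pq M0 r0 F0 TM hp hr.
have q0 : 0 < q by exact: lt_le_trans pq.
apply: (le_trans (strong_type_power p0 q0 M0 TM hp)).
rewrite EFinM -muleA; apply: lee_wpmul2l; first by rewrite lee_fin powR_ge0.
have hE x : `|h x| `^ p = `|h x| `^ (p - r) * `|h x| `^ r.
  have [->|hx0] := eqVneq `|h x| 0; last first.
    by rewrite -powRD ?subrK//; apply/implyP.
  by rewrite (powR0 (lt0r_neq0 p0)) (powR0 (lt0r_neq0 r0)) mulr0.
under [in X in (X `^ _)%E]eq_integral do rewrite hE.
under [in leRHS]eq_integral do rewrite powRrM.
apply: weighted_jensen => //.
- exact: measurable_absr_powR.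
- exact: measurable_absr_powR.
- by rewrite ler_pdivlMr// mul1r.
- by under eq_integral do rewrite -hE.
Qed.

End strong_type_powers.

(** * The interpolation inequality *)

Section interpolation.
Context (R : realType) (d d' : measure_display).
Context (X : measurableType d) (Y : measurableType d').
Variables (mu : {sigma_finite_measure set X -> \bar R}).
Variables (nu : {sigma_finite_measure set Y -> \bar R}).
Variables (T : {mfun X >-> R} -> {mfun Y >-> R}) (p0 p1 q0 q1 : R).
Hypotheses (p0_gt0 : 0 < p0) (p1_gt0 : 0 < p1) (pq0 : p0 <= q0) (pq1 : p1 <= q1).
Hypothesis T_linear : linear_operator_on nu (Lsum mu p0 p1) T.

Lemma large_part_Lsum (f : {mfun X >-> R}) (r v : R) : p0 < r ->
  (\int[mu]_x (`|f x| `^ r)%:E < +oo)%E -> Lsum mu p0 p1 (large_part f v).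
Proof.
move=> pr fr; exists (large_part f v), 0; split.
- by apply: finite_normE; apply: large_part_power_lty pr fr.
- by apply: finite_norm0; rewrite gt_eqF.
- by rewrite addr0.
Qed.

Lemma small_part_Lsum (f : {mfun X >-> R}) (r v : R) : 0 < r -> r < p1 ->
  (\int[mu]_x (`|f x| `^ r)%:E < +oo)%E -> Lsum mu p0 p1 (small_part f v).
Proof.
move=> r0 rp fr; exists 0, (small_part f v); split.
- by apply: finite_norm0; rewrite gt_eqF.
- by apply: finite_normE; apply: small_part_power_lty rp fr.
- by rewrite add0r.
Qed.

(** The exponents A and B are dictated by [strong_type_interpolated]: applied to
    the two parts of f, with ratios q0 / p0 and q1 / p1, it produces exactly the
    densities |f|^(r-A) and |f|^(r+B). *)
Lemma interpolation_powers (A B M0 M1 r F : R) (f : {mfun X >-> R}) :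
  0 < M0 -> 0 < M1 -> strong_type mu nu p0 q0 M0 T -> strong_type mu nu p1 q1 M1 T ->
  p0 < r -> r < p1 -> 0 < F -> (\int[mu]_x (`|f x| `^ r)%:E <= F%:E)%E ->
  A = (r - p0) * (q0 / p0) -> B = (p1 - r) * (q1 / p1) ->
  (\int[nu]_y ((`|T f y| / 2) `^ (q0 * (B / (A + B)) + q1 * (A / (A + B))))%:E <=
   ((M0 `^ q0 * F `^ (q0 / p0 - 1)) `^ (B / (A + B)) *
    (M1 `^ q1 * F `^ (q1 / p1 - 1)) `^ (A / (A + B)) * F)%:E)%E.
Proof.
move=> M0_gt0 M1_gt0 T0 T1 pr rp F0 fF AE BE.
have q0_gt0 : 0 < q0 by exact: lt_le_trans pq0.
have q1_gt0 : 0 < q1 by exact: lt_le_trans pq1.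
have r0 : 0 < r by exact: lt_trans pr.
have A0 : 0 < A by rewrite AE mulr_gt0 ?divr_gt0// subr_gt0.
have B0 : 0 < B by rewrite BE mulr_gt0 ?divr_gt0// subr_gt0.
have fr : (\int[mu]_x (`|f x| `^ r)%:E < +oo)%E by rewrite (le_lt_trans fF)// ltry.
have part_le (h : {mfun X >-> R}) : (forall x, `|h x| <= `|f x|) ->
    (\int[mu]_x (`|h x| `^ r)%:E <= F%:E)%E.
  move=> hf; apply: le_trans fF; apply: ge0_le_integral => //.
  - by apply/measurable_EFinP; exact: measurable_absr_powR.
  - by apply/measurable_EFinP; exact: measurable_absr_powR.
  - by move=> x _; rewrite lee_fin ge0_ler_powR// ?nnegrE// ltW.
apply: (power_integral_le_of_splittings r0 A0 B0 q0_gt0 q1_gt0 _ _ fF).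
- by rewrite mulr_gt0 ?powR_gt0.
- by rewrite mulr_gt0 ?powR_gt0.
move=> v; exists (T (large_part f v)), (T (small_part f v)); split.
- have := T_linear 1 (large_part_Lsum v pr fr) (small_part_Lsum v r0 rp fr).
  by rewrite large_add_small; apply: filterS => y ->; rewrite mul1r.
- have hi_r : (\int[mu]_x (`|large_part f v x| `^ r)%:E <= F%:E)%E.
    by apply: part_le => x; rewrite large_partE; case: ifP => // _; rewrite normr0.
  apply: (le_trans (strong_type_interpolated p0_gt0 pq0 (ltW M0_gt0) r0 F0 T0
    (large_part_power_lty v p0_gt0 pr fr) hi_r)).
  rewrite le_eqVlt; apply/orP; left; apply/eqP; congr (_ * _)%E.
  apply: eq_integral => x _; congr EFin; rewrite /large_density large_partE.
  case: ifP => _; last by rewrite normr0 (powR0 (lt0r_neq0 r0)) mulr0.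
  by rewrite AE -mulNr opprB.
- have lo_r : (\int[mu]_x (`|small_part f v x| `^ r)%:E <= F%:E)%E.
    by apply: part_le => x; rewrite small_partE; case: ifP => // _; rewrite normr0.
  apply: (le_trans (strong_type_interpolated p1_gt0 pq1 (ltW M1_gt0) r0 F0 T1
    (small_part_power_lty v r0 rp fr) lo_r)).
  rewrite le_eqVlt; apply/orP; left; apply/eqP; congr (_ * _)%E.
  apply: eq_integral => x _; congr EFin; rewrite /small_density small_partE.
  by rewrite BE; case: ifP => _ //; rewrite normr0 (powR0 (lt0r_neq0 r0)) mulr0.
Qed.

(** The weights B / (A + B) and A / (A + B) are (1 - th) q / q0 and th q / q1,
    and the total power of N is q by the relations defining r and q. *)
Lemma interpolation_norms_gt0 (M0 M1 th r q N : R) (f : {mfun X >-> R}) :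
  0 < M0 -> 0 < M1 -> strong_type mu nu p0 q0 M0 T -> strong_type mu nu p1 q1 M1 T ->
  p0 < r -> r < p1 -> 0 < q ->
  r^-1 = (1 - th) / p0 + th / p1 -> q^-1 = (1 - th) / q0 + th / q1 ->
  0 < N -> ('N[mu]_(r%:E)[EFin \o f] <= N%:E)%E ->
  ('N[nu]_(q%:E)[EFin \o T f] <= (2 * M0 `^ (1 - th) * M1 `^ th * N)%:E)%E.
Proof.
move=> M0_gt0 M1_gt0 T0 T1 pr rp q_gt0 rE qE N0 fN.
have q0_gt0 : 0 < q0 by exact: lt_le_trans pq0.
have q1_gt0 : 0 < q1 by exact: lt_le_trans pq1.
have r0 : 0 < r by exact: lt_trans pr.
have F0 : 0 < N `^ r by exact: powR_gt0.
have fF : (\int[mu]_x (`|f x| `^ r)%:E <= (N `^ r)%:E)%E.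
  have -> : (\int[mu]_x (`|f x| `^ r)%:E = ('N[mu]_(r%:E)[EFin \o f]) `^ r)%E.
    by rewrite poweR_Lnorm ?gt_eqF.
  rewrite -poweR_EFin; apply: gt0_ler_poweR => //; first exact: ltW.
  - by rewrite in_itv/= Lnorm_ge0 leey.
  - by rewrite in_itv/= leey lee_fin ltW.
have := interpolation_powers M0_gt0 M1_gt0 T0 T1 pr rp F0 fF (erefl _) (erefl _).
set A := (r - p0) * _; set B := (p1 - r) * _.
have [ABE0 ABE1] : B / (A + B) = (1 - th) * q / q0 /\ A / (A + B) = th * q / q1.
  pose D := p0^-1 - p1^-1.
  have D0 : 0 < D by rewrite subr_gt0 ltf_pV2 ?posrE// (lt_trans pr).
  have AE : A = r * D * (th * q0).
    have -> : A = r * q0 * (p0^-1 - r^-1) by rewrite /A; field; rewrite !lt0r_neq0.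
    by rewrite rE /D; ring.
  have BE : B = r * D * ((1 - th) * q1).
    have -> : B = r * q1 * (r^-1 - p1^-1) by rewrite /B; field; rewrite !lt0r_neq0.
    by rewrite rE /D; ring.
  have ABE : A + B = r * D * (q0 * q1 * q^-1).
    by rewrite AE BE qE; field; rewrite !lt0r_neq0.
  by rewrite ABE AE BE; split; field; rewrite !lt0r_neq0.
rewrite ABE0 ABE1.
have -> : q0 * ((1 - th) * q / q0) + q1 * (th * q / q1) = q.
  by field; rewrite !lt0r_neq0.
set C := 2 * _ * _ * N.
have half0 y : 0 <= `|T f y| / 2 by rewrite divr_ge0.
have C0 : 0 < C by rewrite !mulr_gt0 ?powR_gt0.
move=> Tf_le.
have {}Tf_le : (\int[nu]_y (`|T f y| `^ q)%:E <= (C `^ q)%:E)%E.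
  have -> : (\int[nu]_y (`|T f y| `^ q)%:E =
      (2 `^ q)%:E * \int[nu]_y ((`|T f y| / 2) `^ q)%:E)%E.
    rewrite -ge0_integralZl_EFin ?powR_ge0//; last first.
      apply/measurable_EFinP; apply: (measurableT_comp (measurable_powR q)).
      by apply: measurable_funM => //; exact: measurableT_comp.
    apply: eq_integral => y _; rewrite -EFinM -powRM//; congr (_ `^ _)%:E.
    by rewrite mulrC divfK.
  apply: (le_trans (lee_wpmul2l _ Tf_le)).
    by rewrite lee_fin powR_ge0.
  rewrite -EFinM lee_fin le_eqVlt; apply/orP; left; apply/eqP.
  have powRD_gt0 (x y : R) : N `^ (x + y) = N `^ x * N `^ y.
    by rewrite powRD//; apply/implyP => _; rewrite gt_eqF.
  have -> : C `^ q = 2 `^ q * (M0 `^ ((1 - th) * q) * M1 `^ (th * q) * N `^ q).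
    by rewrite /C !powRM ?mulr_ge0 ?powR_ge0 ?ltW// -!powRrM; ring.
  congr (_ * _).
  rewrite !powRM ?powR_ge0// -!powRrM.
  have -> : q0 * ((1 - th) * q / q0) = (1 - th) * q by field; rewrite lt0r_neq0.
  have -> : q1 * (th * q / q1) = th * q by field; rewrite lt0r_neq0.
  have NE : N `^ q = N `^ (r * (q0 / p0 - 1) * ((1 - th) * q / q0)) *
                     N `^ (r * (q1 / p1 - 1) * (th * q / q1)) * N `^ r.
    rewrite -!powRD_gt0; congr (_ `^ _).
    have -> : r * (q0 / p0 - 1) * ((1 - th) * q / q0) +
              r * (q1 / p1 - 1) * (th * q / q1) + r =
              r * q * (((1 - th) / p0 + th / p1) - ((1 - th) / q0 + th / q1)) + r.
      by field; rewrite !lt0r_neq0.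
    by rewrite -rE -qE; field; rewrite !lt0r_neq0.
  by rewrite NE -!mulrA; ring.
rewrite unlock -[leRHS]poweRe1 ?lee_fin ?(ltW C0)//.
rewrite -(@mulfV _ q) ?gt_eqF// poweRrM.
apply: gt0_ler_poweR => //.
- by rewrite invr_ge0 ltW.
- by rewrite in_itv/= leey integral_ge0// => y _; exact: poweR_ge0.
- by rewrite in_itv/= leey lee_fin powR_ge0.
Qed.

End interpolation.

(** * Vanishing constants *)

Section degenerate_constants.
Context (R : realType).

(** Passage from positive constants to nonnegative ones: if one of them is 0,
    then so is the right-hand side, and letting the corresponding positive
    constant shrink gives an arbitrarily small upper bound on x. *)
Lemma le_geometric_mean (x : \bar R) (a b M0 M1 N : R) :
  0 < a -> 0 < b -> 0 <= M0 -> 0 <= M1 -> 0 <= N ->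
  (forall m0 m1 n, 0 < m0 -> 0 < m1 -> 0 < n -> M0 <= m0 -> M1 <= m1 -> N <= n ->
    (x <= (2 * m0 `^ a * m1 `^ b * n)%:E)%E) ->
  (x <= (2 * M0 `^ a * M1 `^ b * N)%:E)%E.
Proof.
move=> a0 b0 M00 M10 N0 xle.
have root (e s : R) : 0 < e -> 0 < s -> (e `^ s^-1) `^ s = e.
  by move=> e0 s0; rewrite -powRrM mulVf ?gt_eqF// powRr1// ltW.
have S0 (z : R) : 0 <= z -> 0 < z + 1 by lra.
have S1 (z : R) : z <= z + 1 by lra.
have [M0z|M0n] := eqVneq M0 0.
  rewrite M0z powR0 ?gt_eqF// mulr0 !mul0r; apply/lee_addgt0Pr => e e0.
  pose K := 2 * (M1 + 1) `^ b * (N + 1).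
  have K0 : 0 < K by rewrite !mulr_gt0 ?powR_gt0 ?S0.
  have eK0 : 0 < e / K by rewrite divr_gt0.
  have := xle ((e / K) `^ a^-1) (M1 + 1) (N + 1).
  rewrite M0z powR_ge0 powR_gt0// !S0// !S1 => /(_ isT isT isT isT isT isT).
  rewrite root// (_ : 2 * _ * _ * _ = e) ?add0e// /K.
  by field; rewrite !lt0r_neq0 ?powR_gt0 ?S0.
have [M1z|M1n] := eqVneq M1 0.
  rewrite M1z powR0 ?gt_eqF// mulr0 !mul0r; apply/lee_addgt0Pr => e e0.
  pose K := 2 * (M0 + 1) `^ a * (N + 1).
  have K0 : 0 < K by rewrite !mulr_gt0 ?powR_gt0 ?S0.
  have eK0 : 0 < e / K by rewrite divr_gt0.
  have := xle (M0 + 1) ((e / K) `^ b^-1) (N + 1).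
  rewrite M1z powR_ge0 powR_gt0// !S0// !S1 => /(_ isT isT isT isT isT isT).
  rewrite root// (_ : 2 * _ * _ * _ = e) ?add0e// /K.
  by field; rewrite !lt0r_neq0 ?powR_gt0 ?S0.
have [Nz|Nn] := eqVneq N 0.
  rewrite Nz mulr0; apply/lee_addgt0Pr => e e0.
  pose K := 2 * (M0 + 1) `^ a * (M1 + 1) `^ b.
  have K0 : 0 < K by rewrite !mulr_gt0 ?powR_gt0 ?S0.
  have eK0 : 0 < e / K by rewrite divr_gt0.
  have := xle (M0 + 1) (M1 + 1) (e / K).
  rewrite Nz (ltW eK0) eK0 !S0// !S1 => /(_ isT isT isT isT isT isT).
  rewrite (_ : 2 * _ * _ * _ = e) ?add0e// /K.
  by field; rewrite !lt0r_neq0 ?powR_gt0 ?S0.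
by apply: xle => //; rewrite lt_neqAle eq_sym ?M0n ?M1n ?Nn.
Qed.

(** A negative constant may be replaced by 0 in the final bound, because by
    convention its powers are 1. *)
Lemma le_powR_max0 (M s : R) : 0 < s -> Num.max M 0 `^ s <= M `^ s.
Proof.
move=> s0; have [M0|M0] := leP 0 M; first by [].
by rewrite powR0 ?gt_eqF// powR_ge0.
Qed.

End degenerate_constants.

(** * Riesz-Thorin for real operators, and the exponents of the theorem *)

Section riesz_thorin.
Context (R : realType) (d d' : measure_display).
Context (X : measurableType d) (Y : measurableType d').

Lemma strong_type_weaken (mu : {measure set X -> \bar R}) (nu : {measure set Y -> \bar R})
    (T : {mfun X >-> R} -> {mfun Y >-> R}) (p q M M' : R) :
  M <= M' -> strong_type mu nu p q M T -> strong_type mu nu p q M' T.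
Proof.
move=> MM' TM f fp; apply: (le_trans (TM f fp)).
by apply: lee_wpmul2r; rewrite ?lee_fin ?Lnorm_ge0.
Qed.

Lemma interpolation_norms (mu : {sigma_finite_measure set X -> \bar R})
    (nu : {sigma_finite_measure set Y -> \bar R})
    (T : {mfun X >-> R} -> {mfun Y >-> R}) (p0 p1 q0 q1 M0 M1 th r q : R)
    (f : {mfun X >-> R}) :
  0 < p0 -> 0 < p1 -> p0 <= q0 -> p1 <= q1 ->
  linear_operator_on nu (Lsum mu p0 p1) T ->
  strong_type mu nu p0 q0 M0 T -> strong_type mu nu p1 q1 M1 T ->
  p0 < r -> r < p1 -> 0 < q -> 0 < th < 1 ->
  r^-1 = (1 - th) / p0 + th / p1 -> q^-1 = (1 - th) / q0 + th / q1 ->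
  finite_norm mu r%:E f ->
  ('N[nu]_(q%:E)[EFin \o T f] <=
   (2 * M0 `^ (1 - th) * M1 `^ th)%:E * 'N[mu]_(r%:E)[EFin \o f])%E.
Proof.
move=> p00 p10 pq0 pq1 Tlin T0 T1 pr rp q_gt0 /andP[th0 th1] rE qE fr.
have th1' : 0 < 1 - th by rewrite subr_gt0.
have Nfin : 'N[mu]_(r%:E)[EFin \o f]%E \is a fin_num by rewrite ge0_fin_numE;
  [exact: fr|exact: Lnorm_ge0].
rewrite -(fineK Nfin) -EFinM; set N := fine _.
have N0 : 0 <= N by apply: fine_ge0; exact: Lnorm_ge0.
have max0 (M : R) : 0 <= Num.max M 0 by rewrite le_max lexx orbT.
apply: (@le_trans _ _
    (2 * Num.max M0 0 `^ (1 - th) * Num.max M1 0 `^ th * N)%:E)%E; last first.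
  rewrite lee_fin ler_wpM2r// ler_pM ?mulr_ge0 ?powR_ge0//.
  - by rewrite ler_wpM2l// le_powR_max0.
  - exact: le_powR_max0.
apply: le_geometric_mean => // m0 m1 n m00 m10 n0.
rewrite !ge_max => /andP[Mm0 _] /andP[Mm1 _] Nn.
apply: (interpolation_norms_gt0 p00 p10 pq0 pq1 Tlin m00 m10
  (strong_type_weaken Mm0 T0) (strong_type_weaken Mm1 T1) pr rp q_gt0 rE qE n0).
by rewrite -(fineK Nfin) lee_fin.
Qed.

Lemma Theta_itv (q0 q1 q : R) : 0 < q0 -> q0 < q -> q < q1 ->
  0 < Theta q0 q1 q < 1.
Proof.
move=> q00 q0q qq1.
have q0_ : 0 < q by exact: lt_trans q0q.
have q10 : 0 < q1 by exact: lt_trans qq1.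
rewrite /Theta; apply/andP; split.
  by rewrite divr_gt0// mulr_gt0// subr_gt0// (lt_trans q0q).
rewrite ltr_pdivrMr ?mulr_gt0// ?subr_gt0 ?(lt_trans q0q)// mul1r.
have : 0 < q0 * (q1 - q) by rewrite mulr_gt0// subr_gt0.
lra.
Qed.

Lemma Theta_inv (q0 q1 q : R) : 0 < q0 -> q0 < q -> q < q1 ->
  q^-1 = (1 - Theta q0 q1 q) / q0 + Theta q0 q1 q / q1.
Proof.
move=> q00 q0q qq1.
have q0_ : 0 < q by exact: lt_trans q0q.
have q10 : 0 < q1 by exact: lt_trans qq1.
rewrite /Theta; field.
by rewrite !lt0r_neq0// subr_gt0 (lt_trans q0q).
Qed.

Lemma r_RT_inv (p0 p1 q0 q1 q : R) : 0 < p0 -> 0 < p1 -> 0 < q0 -> q0 < q -> q < q1 ->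
  (r_RT p0 p1 q0 q1 q)^-1 = (1 - Theta q0 q1 q) / p0 + Theta q0 q1 q / p1.
Proof.
move=> p00 p10 q00 q0q qq1.
have q0_ : 0 < q by exact: lt_trans q0q.
have q10 : 0 < q1 by exact: lt_trans qq1.
have den0 : 0 < p0 * q1 * (q - q0) + p1 * q0 * (q1 - q).
  by rewrite addr_gt0// !mulr_gt0// subr_gt0.
rewrite /r_RT /Theta; field.
by rewrite !lt0r_neq0// subr_gt0 (lt_trans q0q).
Qed.

Lemma r_RT_itv (p0 p1 q0 q1 q : R) : 0 < p0 -> p0 < p1 -> 0 < q0 -> q0 < q -> q < q1 ->
  p0 < r_RT p0 p1 q0 q1 q < p1.
Proof.
move=> p00 p01 q00 q0q qq1.
have p10 : 0 < p1 by exact: lt_trans p01.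
have q0_ : 0 < q by exact: lt_trans q0q.
have q10 : 0 < q1 by exact: lt_trans qq1.
have den0 : 0 < p0 * q1 * (q - q0) + p1 * q0 * (q1 - q).
  by rewrite addr_gt0// !mulr_gt0// subr_gt0.
have h0 : 0 < (p1 - p0) * (q1 * (q - q0)) by rewrite !mulr_gt0// subr_gt0.
have h1 : 0 < (p1 - p0) * (q0 * (q1 - q)) by rewrite !mulr_gt0// subr_gt0.
rewrite /r_RT ltr_pdivlMr// ltr_pdivrMr//; apply/andP; split.
- have -> : p0 * p1 * (q1 - q0) * q = p0 * (p1 * (q1 - q0) * q) by ring.
  rewrite ltr_pM2l//; lra.
- have -> : p0 * p1 * (q1 - q0) * q = p1 * (p0 * (q1 - q0) * q) by ring.
  rewrite ltr_pM2l//; lra.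
Qed.

End riesz_thorin.

(** * Grand Lebesgue norms *)

Theorem theorem5p1 (R : realType) (d d' : measure_display)
    (X : measurableType d) (Y : measurableType d')
    (mu : {sigma_finite_measure set X -> \bar R})
    (nu : {sigma_finite_measure set Y -> \bar R})
    (mu_nontrivial : (0 < mu [set: X])%E) (nu_nontrivial : (0 < nu [set: Y])%E)
    (mu_resonant : resonant mu) (nu_resonant : resonant nu)
    (p0 p1 q0 q1 : R)
    (p0_ge1 : 1 <= p0) (p1_ge1 : 1 <= p1) (q0_ge1 : 1 <= q0) (q1_ge1 : 1 <= q1)
    (le_p0q0 : p0 <= q0) (le_p1q1 : p1 <= q1)
    (lt_p0p1 : p0 < p1) (lt_q0q1 : q0 < q1)
    (T : {mfun X >-> R} -> {mfun Y >-> R})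
    (T_linear : linear_operator_on nu (Lsum mu p0 p1) T)
    (M0 M1 : R)
    (T_strong0 : strong_type mu nu p0 q0 M0 T)
    (T_strong1 : strong_type mu nu p1 q1 M1 T)
    (psi : R -> R) (psi_Psi : Psi p0 p1 psi)
    (f : {mfun X >-> R}) (f_Gpsi : GLspace mu p0 p1 psi f) :
  (GLnorm nu q0 q1 (psi_RT p0 p1 q0 q1 M0 M1 psi) (T f)
   <= GLnorm mu p0 p1 psi f)%E.
Proof.
have p0_gt0 : 0 < p0 by exact: lt_le_trans p0_ge1.
have p1_gt0 : 0 < p1 by exact: lt_le_trans p1_ge1.
have q0_gt0 : 0 < q0 by exact: lt_le_trans q0_ge1.
have q1_gt0 : 0 < q1 by exact: lt_le_trans q1_ge1.
apply: ge_ereal_sup => _ [q + <-]; rewrite /= in_itv/= => /andP[q0q qq1].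
have q_gt0 : 0 < q by exact: lt_trans q0q.
have /andP[pr rp] := r_RT_itv p0_gt0 lt_p0p1 q0_gt0 q0q qq1.
rewrite /psi_RT; set r := r_RT p0 p1 q0 q1 q in pr rp *.
have [_ /(_ r) psi_gt0 _] := psi_Psi.
have psir : 0 < psi r by apply: psi_gt0; rewrite pr.
have le_GL : ('N[mu]_(r%:E)[EFin \o f] / (psi r)%:E <= GLnorm mu p0 p1 psi f)%E.
  by apply: ereal_sup_ubound; exists r => //=; rewrite in_itv/= pr.
have fr : finite_norm mu r%:E f.
  have := le_lt_trans le_GL f_Gpsi; rewrite /finite_norm inver gt_eqF//.
  by rewrite lte_pdivrMr// gt0_mulye.
apply: le_trans le_GL.
have := interpolation_norms p0_gt0 p1_gt0 le_p0q0 le_p1q1 T_linear T_strong0 T_strong1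
  pr rp q_gt0 (Theta_itv q0_gt0 q0q qq1)
  (r_RT_inv p0_gt0 p1_gt0 q0_gt0 q0q qq1) (Theta_inv q0_gt0 q0q qq1) fr.
rewrite -/(M_theta M0 M1 q0 q1 q); set M := M_theta _ _ _ _ _ => Tf_le.
have M_ge0 : 0 <= M by rewrite !mulr_ge0 ?powR_ge0.
(* if M = 0, then T f = 0 almost everywhere and the quotient is 0 / 0 = 0 *)
have [Mz|Mn0] := eqVneq M 0.
  move: Tf_le; rewrite Mz mul0e => Tf_le.
  have -> : ('N[nu]_(q%:E)[EFin \o T f] = 0)%E by apply/eqP; rewrite eq_le Tf_le Lnorm_ge0.
  by rewrite mul0e mule_ge0 ?Lnorm_ge0 ?inve_ge0// lee_fin ltW.
have M_gt0 : 0 < M by rewrite lt_neqAle eq_sym Mn0.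
have Mpsi_gt0 : 0 < M * psi r by exact: mulr_gt0.
rewrite !inver !gt_eqF// lee_pdivrMr//.
apply: (le_trans Tf_le); rewrite -muleA -EFinM mulrCA mulVf ?gt_eqF// mulr1 muleC.
exact: lexx.
Qed.
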